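(* In the (completed) tensor square of $\mathfrak D_{\mathfrak{sl}_2}$ the following identity holds: $$q^{\frac12c\otimes c}\,q^{\frac12c\otimes H'}\,R_{\mathfrak D_{\mathfrak{sl}_2}}\,q^{-\frac12H'\otimes c}=\check R_{\mathfrak D_{\mathfrak{sl}_2}}.$$
   Context: Let $k$ be a field of characteristic zero, $q=e^h$, $[n]_q=\frac{q^n-q^{-n}}{q-q^{-1}}$. $\mathfrak D_{\mathfrak{sl}_2}$ is the topological $k[[h]]$-algebra generated by $E,F,H,\widetilde H$ with relations $[H,E]=2E$, $[\widetilde H,E]=-2E$, $[H,F]=-2F$, $[\widetilde H,F]=2F$, $[E,F]=\frac{q^H-q^{\widetilde H}}{q-q^{-1}}$, $[H,\widetilde H]=0$. Its universal $R$-matrix is $$R_{\mathfrak D_{\mathfrak{sl}_2}}=\sum_{n=0}^\infty\frac{(q-q^{-1})^n}{[n]_q!}q^{-\frac{H\otimes\widetilde H}2+\frac{n(n-1)}2}E^n\otimes F^n.$$ Set $c=-\frac{H+\widetilde H}2$ (a central element), $H'=H+c=-\widetilde H-c$, $E'=E$, $F'=e^{hc}F$, and $$\check R_{\mathfrak D_{\mathfrak{sl}_2}}=\sum_{n=0}^\infty\frac{(q-q^{-1})^n}{[n]_q!}q^{\frac{H'\otimes H'}2+\frac{n(n-1)}2}E'^n\otimes F'^n.$$ *)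

(* Defs.v *)
From HB Require Import structures.
From mathcomp Require Import all_boot all_order all_algebra.
From mathcomp Require Import boolp.
From mathcomp Require Import monalg.

Set Implicit Arguments.
Unset Strict Implicit.
Unset Printing Implicit Defensive.

Import GRing.Theory.
Local Open Scope ring_scope.

(* [fps A] is A[[h]]; if A is a k-algebra, it is a k[[h]]-algebra. *)
Record fps (A : Type) := FPS { coef : nat -> A }.

Lemma fpsP (A : Type) (f g : fps A) : (forall n, coef f n = coef g n) <-> f = g.
Proof.
split=> [|-> //]; case: f g => f [g] /= fg.
by congr FPS; apply: functional_extensionality_dep.
Qed.

HB.instance Definition _ (A : Type) := gen_eqMixin (fps A).
HB.instance Definition _ (A : Type) := gen_choiceMixin (fps A).

Section FpsZmodule.
Variable A : zmodType.
Implicit Types f g : fps A.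

Definition fps0 : fps A := FPS (fun=> 0).
Definition fps_opp f : fps A := FPS (fun n => - coef f n).
Definition fps_add f g : fps A := FPS (fun n => coef f n + coef g n).

Fact fps_addA : associative fps_add.
Proof. by move=> f g l; apply/fpsP=> n /=; rewrite addrA. Qed.
Fact fps_addC : commutative fps_add.
Proof. by move=> f g; apply/fpsP=> n /=; rewrite addrC. Qed.
Fact fps_add0 : left_id fps0 fps_add.
Proof. by move=> f; apply/fpsP=> n /=; rewrite add0r. Qed.
Fact fps_addN : left_inverse fps0 fps_opp fps_add.
Proof. by move=> f; apply/fpsP=> n /=; rewrite addNr. Qed.

HB.instance Definition _ := GRing.isZmodule.Build (fps A)
  fps_addA fps_addC fps_add0 fps_addN.

Lemma coef_fps0 n : coef (0 : fps A) n = 0. Proof. by []. Qed.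
Lemma coef_fpsN f n : coef (- f) n = - coef f n. Proof. by []. Qed.
Lemma coef_fpsD f g n : coef (f + g) n = coef f n + coef g n.
Proof. by []. Qed.
Lemma coef_fpsB f g n : coef (f - g) n = coef f n - coef g n.
Proof. by []. Qed.

(* The constant series. *)
Definition fpsC (a : A) : fps A := FPS (fun n => if n is 0 then a else 0).

(* f / h, meaningful when the constant term of f vanishes. *)
Definition fps_divh f : fps A := FPS (fun n => coef f n.+1).
End FpsZmodule.

Section FpsRing.
Variable A : pzRingType.
Implicit Types f g : fps A.

Definition fps1 : fps A := fpsC 1.
Definition fps_mul f g : fps A :=
  FPS (fun n => \sum_(i < n.+1) coef f i * coef g (n - i)).

Lemma coef_fps_mul_rev f g n :
  coef (fps_mul f g) n = \sum_(i < n.+1) coef f (n - i) * coef g i.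
Proof.
rewrite /= (reindex_inj rev_ord_inj) /=; apply: eq_bigr => i _.
by rewrite subSS subKn // -ltnS.
Qed.

Fact fps_mulA : associative fps_mul.
Proof.
move=> p q r; apply/fpsP=> i; rewrite [RHS]coef_fps_mul_rev [LHS]/=.
pose coef3 j k := coef p j * (coef q (i - j - k) * coef r k).
transitivity (\sum_(j < i.+1) \sum_(k < i.+1 | (k <= i - j)%N) coef3 j k).
  apply: eq_bigr => j _; rewrite -[X in _ * X]/(coef (fps_mul q r) (i - j)).
  rewrite coef_fps_mul_rev big_distrr /=.
  by rewrite (big_ord_narrow_leq (leq_subr _ _)).
rewrite (exchange_big_dep predT) //=; apply: eq_bigr => k _.
transitivity (\sum_(j < i.+1 | (j <= i - k)%N) coef3 j k).
  apply: eq_bigl => j; rewrite -ltnS -(ltnS j) -!subSn ?leq_ord //.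
  by rewrite -subn_gt0 -(subn_gt0 j) -!subnDA addnC.
rewrite (big_ord_narrow_leq (leq_subr _ _)) big_distrl /=.
by apply: eq_bigr => j _; rewrite /coef3 -!subnDA addnC mulrA.
Qed.

Fact fps_mul1 : left_id fps1 fps_mul.
Proof.
move=> f; apply/fpsP=> n /=; rewrite big_ord_recl big1 /= => [|i _].
  by rewrite mul1r addr0 subn0.
by rewrite mul0r.
Qed.

Fact fps_mulr1 : right_id fps1 fps_mul.
Proof.
move=> f; apply/fpsP=> n; rewrite coef_fps_mul_rev.
rewrite big_ord_recl big1 /= => [|i _].
  by rewrite mulr1 addr0 subn0.
by rewrite mulr0.
Qed.

Fact fps_mulDl : left_distributive fps_mul +%R.
Proof.
move=> f g l; apply/fpsP=> n /=; rewrite -big_split /=.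
by apply: eq_bigr => i _; rewrite mulrDl.
Qed.

Fact fps_mulDr : right_distributive fps_mul +%R.
Proof.
move=> f g l; apply/fpsP=> n /=; rewrite -big_split /=.
by apply: eq_bigr => i _; rewrite mulrDr.
Qed.

HB.instance Definition _ := GRing.Zmodule_isPzRing.Build (fps A)
  fps_mulA fps_mul1 fps_mulr1 fps_mulDl fps_mulDr.

Lemma coef_fps1 n : coef (1 : fps A) n = (n == 0)%N%:R.
Proof. by case: n. Qed.

Lemma coef_fpsM f g n :
  coef (f * g) n = \sum_(i < n.+1) coef f i * coef g (n - i).
Proof. by []. Qed.

Lemma coef_fpsMrev f g n :
  coef (f * g) n = \sum_(i < n.+1) coef f (n - i) * coef g i.
Proof. exact: coef_fps_mul_rev. Qed.

(* The formal variable h. *)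
Definition fpsX : fps A := FPS (fun n => (n == 1)%N%:R).

Lemma coef_fpsXM f n : coef (fpsX * f) n = if n is m.+1 then coef f m else 0.
Proof.
rewrite coef_fpsM big_ord_recl mul0r add0r; case: n => [|n].
  by rewrite big_ord0.
rewrite big_ord_recl big1 /= => [|i _]; first by rewrite mul1r subSS subn0 addr0.
by rewrite mul0r.
Qed.

Lemma fps_divhK f : coef f 0 = 0 -> fpsX * fps_divh f = f.
Proof. by move=> f0; apply/fpsP=> -[|n]; rewrite coef_fpsXM. Qed.
End FpsRing.

Arguments fpsX {A}.

Fact fps_oner_neq0 (A : nzRingType) : (1 : fps A) != 0.
Proof.
apply/eqP => /fpsP /(_ 0%N) /eqP.
by rewrite coef_fps1 coef_fps0 oner_eq0.
Qed.

HB.instance Definition _ (A : nzRingType) :=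
  GRing.PzSemiRing_isNonZero.Build (fps A) (fps_oner_neq0 A).

Fact fps_mulC (A : comPzRingType) : commutative (@GRing.mul (fps A)).
Proof.
move=> f g; apply/fpsP=> n; rewrite coef_fpsM coef_fpsMrev.
by apply: eq_bigr => i _; rewrite mulrC.
Qed.

HB.instance Definition _ (A : comPzRingType) :=
  GRing.PzRing_hasCommutativeMul.Build (fps A) (@fps_mulC A).

Section FpsUnit.
Variable k : fieldType.
Implicit Types f g : fps k.

Definition fps_unit : {pred fps k} := [pred f | coef f 0 != 0].

Fixpoint fps_inv_seq f n : seq k :=
  if n is m.+1 then
    let s := fps_inv_seq f m in
    rcons s (- (coef f 0)^-1 * \sum_(i < m.+1) coef f i.+1 * s`_(m - i))
  else [:: (coef f 0)^-1].

Definition fps_inv f : fps k :=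
  if f \in fps_unit then FPS (fun n => (fps_inv_seq f n)`_n) else f.

Lemma size_fps_inv_seq f n : size (fps_inv_seq f n) = n.+1.
Proof. by elim: n => //= n IHn; rewrite size_rcons IHn. Qed.

Lemma nth_fps_inv_seq f n m : (m <= n)%N ->
  (fps_inv_seq f n)`_m = (fps_inv_seq f m)`_m.
Proof.
elim: n => [|n IHn]; first by rewrite leqn0 => /eqP->.
rewrite leq_eqVlt => /orP[/eqP-> // | lt_mn].
by rewrite /= nth_rcons size_fps_inv_seq lt_mn IHn.
Qed.

Fact fps_mulVx : {in fps_unit, left_inverse 1 fps_inv *%R}.
Proof.
move=> f uf; rewrite mulrC; apply/fpsP=> n.
rewrite /fps_inv uf coef_fpsM coef_fps1 /=; case: n => [|n].
  by rewrite big_ord1 /= mulfV.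
rewrite big_ord_recl subn0 /= nth_rcons size_fps_inv_seq ltnn eqxx.
rewrite mulrA mulrN mulfV // mulN1r; apply/eqP; rewrite addrC subr_eq0.
apply/eqP; apply: eq_bigr => i _; rewrite /bump /= add1n subSS.
by rewrite [in RHS]nth_fps_inv_seq ?leq_subr.
Qed.

Fact fps_unitPl f g : g * f = 1 -> f \in fps_unit.
Proof.
move=> /fpsP /(_ 0%N); rewrite coef_fpsM coef_fps1 big_ord1 /= => gf1.
rewrite inE; apply: contra_eq_neq gf1 => ->.
by rewrite mulr0 eq_sym oner_eq0.
Qed.

Fact fps_inv_out : {in [predC fps_unit], fps_inv =1 id}.
Proof. by move=> f /negPf uf; rewrite /fps_inv uf. Qed.

HB.instance Definition _ := GRing.ComNzRing_hasMulInverse.Build (fps k)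
  fps_mulVx fps_unitPl fps_inv_out.
End FpsUnit.

(* A k[[h]]-algebra, as a ring with a central ring morphism from k[[h]].  The
   zero ring is allowed, which MathComp's [algType (fps k)] would exclude. *)
HB.mixin Record hasHScalars (k : comNzRingType) A of GRing.PzRing A := {
  hscal : fps k -> A;
  hscal1 : hscal 1 = 1;
  hscalD : {morph hscal : c d / c + d};
  hscalM : {morph hscal : c d / c * d};
  hscalC : forall c x, hscal c * x = x * hscal c
}.

#[short(type="hAlgType")]
HB.structure Definition HAlgebra (k : comNzRingType) :=
  {A of GRing.PzRing A & hasHScalars k A}.

Notation "c %:H" := (hscal c) (at level 2, left associativity, format "c %:H").

Section FpsAlgebra.
Variables (k : comNzRingType) (A : algType k).
Implicit Types (c : fps k) (f : fps A).

Definition fps_in_alg c : fps A := FPS (fun n => (coef c n)%:A).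

Fact fps_in_alg1 : fps_in_alg 1 = 1.
Proof. by apply/fpsP=> -[|n] /=; rewrite ?scale1r ?scale0r. Qed.

Fact fps_in_algD : {morph fps_in_alg : c d / c + d}.
Proof. by move=> c d; apply/fpsP=> n /=; rewrite scalerDl. Qed.

Fact fps_in_algM : {morph fps_in_alg : c d / c * d}.
Proof.
move=> c d; apply/fpsP=> n; rewrite coef_fpsM /= scaler_suml.
by apply: eq_bigr => i _; rewrite -scalerAl mul1r scalerA.
Qed.

Fact fps_in_algC c f : fps_in_alg c * f = f * fps_in_alg c.
Proof.
apply/fpsP=> n; rewrite coef_fpsM coef_fpsMrev; apply: eq_bigr => i _ /=.
by rewrite -scalerAl -scalerAr mul1r mulr1.
Qed.

HB.instance Definition _ := hasHScalars.Build k (fps A)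
  fps_in_alg1 fps_in_algD fps_in_algM fps_in_algC.
End FpsAlgebra.

Section HAdic.
Variable k : fieldType.
Implicit Type A : hAlgType k.

(* x lies in h^m A. *)
Definition hdvd A (m : nat) (x : A) : Prop :=
  exists y : A, x = (fpsX ^+ m)%:H * y.

Definition hcvg A (u : nat -> A) (l : A) : Prop :=
  forall m, exists N, forall n, (N <= n)%N -> hdvd m (u n - l).

(* The h-adic limit of u, and 0 if u does not converge. *)
Definition hlim A (u : nat -> A) : A :=
  if pselect (exists l, hcvg u l) is left u_cvg then projT1 (cid u_cvg) else 0.

Definition hsum A (u : nat -> A) : A := hlim (fun N => \sum_(n < N) u n).

(* [qexp x] is q^x = e^{hx}, so that h itself does not appear in x. *)
Definition qexp A (x : A) : A :=
  hsum (fun n => (fpsX ^+ n / n`!%:R)%:H * x ^+ n).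

Inductive in_ideal (A : pzRingType) (S : A -> Prop) : A -> Prop :=
| in_ideal_gen x of S x : in_ideal S x
| in_ideal0 : in_ideal S 0
| in_idealD x y of in_ideal S x & in_ideal S y : in_ideal S (x + y)
| in_idealMl a x of in_ideal S x : in_ideal S (a * x)
| in_idealMr a x of in_ideal S x : in_ideal S (x * a).

(* The h-adic closure of the two-sided ideal generated by S. *)
Definition in_hideal A (S : A -> Prop) (x : A) : Prop :=
  forall m, exists2 y, in_ideal S y & hdvd m (x - y).

Definition hideal A (S : A -> Prop) : {pred A} := fun x => `[< in_hideal S x >].

Lemma in_idealN (A : pzRingType) (S : A -> Prop) x :
  in_ideal S x -> in_ideal S (- x).
Proof. by rewrite -mulN1r; apply: in_idealMl. Qed.

Lemma hdvdD A m (x y : A) : hdvd m x -> hdvd m y -> hdvd m (x + y).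
Proof. by move=> [a ->] [b ->]; exists (a + b); rewrite mulrDr. Qed.

Lemma hdvdN A m (x : A) : hdvd m x -> hdvd m (- x).
Proof. by move=> [a ->]; exists (- a); rewrite mulrN. Qed.

Section HIdeal.
Variables (A : hAlgType k) (S : A -> Prop).

Fact hideal_zmod_closed : zmod_closed (hideal S).
Proof.
split=> [|x y /asboolP Ix /asboolP Iy]; apply/asboolP => m.
  by exists 0; [exact: in_ideal0 | exists 0; rewrite mulr0 subr0].
have [[a Ia xa] [b Ib yb]] := (Ix m, Iy m).
exists (a - b); first by apply: in_idealD => //; apply: in_idealN.
by rewrite opprD addrACA -opprD; apply: hdvdD => //; apply: hdvdN.
Qed.

Lemma hidealMl a x : x \in hideal S -> a * x \in hideal S.
Proof.
move=> /asboolP Ix; apply/asboolP => m; have [y Iy [z xz]] := Ix m.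
exists (a * y); first exact: in_idealMl.
by exists (a * z); rewrite -mulrBr xz !mulrA hscalC.
Qed.

Lemma hidealMr a x : x \in hideal S -> x * a \in hideal S.
Proof.
move=> /asboolP Ix; apply/asboolP => m; have [y Iy [z xz]] := Ix m.
exists (y * a); first exact: in_idealMr.
by exists (z * a); rewrite -mulrBl xz mulrA.
Qed.

HB.instance Definition _ :=
  GRing.isZmodClosed.Build A (hideal S) hideal_zmod_closed.
End HIdeal.
End HAdic.

Section HAdicFps.
Variables (k : fieldType) (A : algType k).
Implicit Type f : fps A.

Lemma hscalXn (B : hAlgType k) (c : fps k) m : (c ^+ m)%:H = c%:H ^+ m :> B.
Proof. by elim: m => [|m IHm]; rewrite ?hscal1 // !exprS hscalM IHm. Qed.

Lemma coef_hscalXnM f m n :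
  coef ((fpsX ^+ m)%:H * f) n = if (n < m)%N then 0 else coef f (n - m).
Proof.
rewrite hscalXn; have -> : fpsX%:H = fpsX :> fps A.
  by apply/fpsP=> -[|[|i]] /=; rewrite ?scale1r ?scale0r.
elim: m f n => [|m IHm] f n; first by rewrite mul1r subn0.
by rewrite exprS -mulrA coef_fpsXM; case: n => [|n] //; rewrite IHm ltnS subSS.
Qed.

Lemma hdvd_fpsP m f : hdvd m f <-> forall n, (n < m)%N -> coef f n = 0.
Proof.
split=> [[g ->] n lt_nm | f0]; first by rewrite coef_hscalXnM lt_nm.
exists (FPS (fun n => coef f (n + m))); apply/fpsP=> n.
rewrite coef_hscalXnM; case: ltnP => [/f0-> //|le_mn /=].
by rewrite subnK.
Qed.

Lemma fps_separated f : (forall m, hdvd m f) -> f = 0.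
Proof. by move=> f0; apply/fpsP=> n; have /hdvd_fpsP->  := f0 n.+1. Qed.

Lemma fps_complete (u : nat -> fps A) : (forall n, hdvd n (u n)) ->
  hcvg (fun N => \sum_(n < N) u n)
       (FPS (fun m => coef (\sum_(n < m.+1) u n) m)).
Proof.
move=> hu m; exists m => N le_mN; apply/hdvd_fpsP => n lt_nm.
rewrite coef_fpsB /=; apply/eqP; rewrite subr_eq0; apply/eqP.
elim: N le_mN => [|N IHN]; first by rewrite leqn0 => /eqP m0; rewrite m0 in lt_nm.
rewrite leq_eqVlt => /orP[/eqP eq_mN|]; last first.
  rewrite ltnS => le_mN; rewrite big_ord_recr coef_fpsD IHN //.
  have /hdvd_fpsP-> // := hu N; first by rewrite addr0.
  exact: leq_trans le_mN.
rewrite -{}eq_mN {IHN N} [in RHS](big_ord_widen m) //.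
rewrite [in LHS](bigID (fun i : 'I_m => (i < n.+1)%N)) coef_fpsD.
rewrite addrC; set s := (X in coef X n + _).
suff -> : coef s n = 0 by rewrite add0r.
rewrite {}/s; apply: (big_ind (fun f => coef f n = 0)) => // [f g f0 g0|i].
  by rewrite coef_fpsD f0 g0 addr0.
by rewrite -leqNgt => lt_ni; have /hdvd_fpsP-> := hu i.
Qed.
End HAdicFps.

Lemma hlimP (k : fieldType) (A : hAlgType k) (u : nat -> A) (l : A) :
  (forall x : A, (forall m, hdvd m x) -> x = 0) -> hcvg u l -> hlim u = l.
Proof.
move=> sepA ul; rewrite /hlim; case: pselect => [e|]; last by case; exists l.
case: (cid e) => l' /= ul'; apply/eqP; rewrite -subr_eq0; apply/eqP/sepA => m.
have [[N uN] [N' uN']] := (ul m, ul' m).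
have := uN _ (leq_maxl N N'); have /hdvdN := uN' _ (leq_maxr N N').
rewrite opprB => d1 d2; have := hdvdD d1 d2.
by rewrite addrA subrK.
Qed.

(* The free algebra k<X>: the monoid algebra of the free monoid on X. *)
Definition freealg (k : comNzRingType) (X : choiceType) : Type :=
  {malg k[{fmonom X}]}.

HB.instance Definition _ (k : comNzRingType) (X : choiceType) :=
  GRing.Lalgebra.on (freealg k X).

Fact freealg_scalerAr (k : comNzRingType) (X : choiceType)
  (a : k) (x y : freealg k X) : a *: (x * y) = x * (a *: y).
Proof.
rewrite -[a *: y]mul_malgC mulrA -[a *: (x * y)]mul_malgC mulrA.
congr (_ * y); rewrite [LHS]mul_malgC [RHS](@fgmulgU {fmonom X} k).
rewrite [in LHS](monalgE x) scaler_sumr.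
apply: eq_bigr => w _; rewrite mulm1 mulrC; apply/malgP => v.
by rewrite mcoeffZ !mcoeffU mulrnAr.
Qed.

HB.instance Definition _ (k : comNzRingType) (X : choiceType) :=
  GRing.Lalgebra_isAlgebra.Build k (freealg k X)
    (@freealg_scalerAr k X).

(* k<X>[[h]]: the h-adic completion of the free k[[h]]-algebra on X. *)
Definition tfree (k : fieldType) (X : choiceType) : Type :=
  fps (freealg k X).

HB.instance Definition _ (k : fieldType) (X : choiceType) :=
  HAlgebra.on (tfree k X).

Definition tvar (k : fieldType) (X : choiceType) (x : X) : tfree k X :=
  fpsC (<< fmu x >> : freealg k X).

(* The topological k[[h]]-algebra with generators X and relators S: the
   quotient of k<X>[[h]] by the closed two-sided ideal generated by S. *)
Definition tpres (k : fieldType) (X : choiceType) (S : tfree k X -> Prop) :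
  Type := Quotient.quot (hideal S).

Section TPres.
Local Open Scope quotient_scope.
Variables (k : fieldType) (X : choiceType) (S : tfree k X -> Prop).
Local Notation Q := (tpres S).

HB.instance Definition _ := GRing.Zmodule.on Q.
HB.instance Definition _ :=
  EqQuotient.copy Q (Quotient.quot (hideal S)).

Definition tpi (x : tfree k X) : Q := \pi_Q x.

Lemma tpi_eq x y : tpi x = tpi y <-> x - y \in hideal S.
Proof.
rewrite -[tpi x]/(\pi_(Quotient.quot (hideal S)) x).
rewrite -[tpi y]/(\pi_(Quotient.quot (hideal S)) y).
by rewrite Quotient.idealrBE; split=> [->|/eqP].
Qed.

Lemma tpi_repr (x : Q) : tpi (repr x) = x. Proof. exact: reprK. Qed.

Lemma tpi_surj (x : Q) : exists y, x = tpi y.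
Proof. by exists (repr x); rewrite tpi_repr. Qed.

Lemma tpiD : {morph tpi : x y / x + y}.
Proof. by move=> x y; rewrite /tpi; exact: Quotient.pi_add. Qed.

Definition tpres_mul (x y : Q) : Q := tpi (repr x * repr y).

Lemma tpres_mulE x y : tpres_mul (tpi x) (tpi y) = tpi (x * y).
Proof.
rewrite /tpres_mul; apply/tpi_eq.
have /tpi_eq := tpi_repr (tpi x); have /tpi_eq := tpi_repr (tpi y).
move: (repr (tpi x)) (repr (tpi y)) => a b Ib Ia.
have -> : a * b - x * y = (a - x) * b + x * (b - y).
  by rewrite mulrBl mulrBr addrA subrK.
by apply: rpredD; [exact: hidealMr | exact: hidealMl].
Qed.

Fact tpres_mulA : associative tpres_mul.
Proof.
move=> x y z; have [[a ->] [b ->] [c ->]] := And3 (tpi_surj x) (tpi_surj y) (tpi_surj z).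
by rewrite !tpres_mulE mulrA.
Qed.

Fact tpres_mul1 : left_id (tpi 1) tpres_mul.
Proof. by move=> x; have [a ->] := tpi_surj x; rewrite tpres_mulE mul1r. Qed.

Fact tpres_mulr1 : right_id (tpi 1) tpres_mul.
Proof. by move=> x; have [a ->] := tpi_surj x; rewrite tpres_mulE mulr1. Qed.

Fact tpres_mulDl : left_distributive tpres_mul +%R.
Proof.
move=> x y z; have [[a ->] [b ->] [c ->]] := And3 (tpi_surj x) (tpi_surj y) (tpi_surj z).
by rewrite -(tpiD a b) !tpres_mulE -(tpiD (a * c)) mulrDl.
Qed.

Fact tpres_mulDr : right_distributive tpres_mul +%R.
Proof.
move=> x y z; have [[a ->] [b ->] [c ->]] := And3 (tpi_surj x) (tpi_surj y) (tpi_surj z).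
by rewrite -(tpiD b c) !tpres_mulE -(tpiD (a * b)) mulrDr.
Qed.

HB.instance Definition _ := GRing.Zmodule_isPzRing.Build Q
  tpres_mulA tpres_mul1 tpres_mulr1 tpres_mulDl tpres_mulDr.

Lemma tpiM : {morph tpi : x y / x * y}.
Proof. by move=> x y; rewrite -tpres_mulE. Qed.

Definition tpres_scal (c : fps k) : Q := tpi c%:H.

Fact tpres_scal1 : tpres_scal 1 = 1.
Proof. by rewrite /tpres_scal hscal1. Qed.
Fact tpres_scalD : {morph tpres_scal : c d / c + d}.
Proof. by move=> c d; rewrite /tpres_scal hscalD tpiD. Qed.
Fact tpres_scalM : {morph tpres_scal : c d / c * d}.
Proof. by move=> c d; rewrite /tpres_scal hscalM tpiM. Qed.
Fact tpres_scalC c x : tpres_scal c * x = x * tpres_scal c.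
Proof. by have [y ->] := tpi_surj x; rewrite -!tpiM hscalC. Qed.

HB.instance Definition _ := hasHScalars.Build k Q
  tpres_scal1 tpres_scalD tpres_scalM tpres_scalC.

Lemma tpi0 : tpi 0 = 0.
Proof. by apply: (addrI (tpi 0)); rewrite -tpiD !addr0. Qed.

Lemma tpiB : {morph tpi : x y / x - y}.
Proof.
move=> x y; apply: (addIr (tpi y)).
by rewrite -(tpiD (x - y) y) -(addrA (tpi x)) addNr addr0 subrK.
Qed.
Lemma hdvd_tpi m x : hdvd m x -> hdvd m (tpi x).
Proof. by move=> [y ->]; exists (tpi y); rewrite tpiM. Qed.

Lemma tpres_separated (x : Q) : (forall m, hdvd m x) -> x = 0.
Proof.
have [a ->] := tpi_surj x => hx; rewrite -tpi0; apply/tpi_eq; rewrite subr0.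
apply/asboolP => m; have [y] := hx m; have [b ->] := tpi_surj y.
rewrite -[_%:H]/(tpi _) -tpiM => /tpi_eq/asboolP/(_ m)[c Ic dc].
exists c => //; rewrite -(subrK ((fpsX ^+ m)%:H * b) a) addrAC.
by apply: hdvdD => //; exists b.
Qed.

Lemma tpres_complete (u : nat -> Q) : (forall n, hdvd n (u n)) ->
  exists l, hcvg (fun N => \sum_(n < N) u n) l.
Proof.
move=> hu; pose v n := (fpsX ^+ n)%:H * repr (projT1 (cid (hu n))).
have uE n : u n = tpi (v n).
  by rewrite /v tpiM tpi_repr; case: (cid _) => y.
have hv n : hdvd n (v n) by exists (repr (projT1 (cid (hu n)))).
have sumE N : \sum_(n < N) u n = tpi (\sum_(n < N) v n).
  elim: N => [|N IHN]; last by rewrite !big_ord_recr /= tpiD IHN uE.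
  by rewrite !big_ord0 tpi0.
have vl := fps_complete hv; exists (tpi (FPS (fun m => coef (\sum_(n < m.+1) v n) m))) => m; have [N vN] := vl m.
exists N => n le_Nn; rewrite sumE -tpiB; exact: hdvd_tpi (vN n le_Nn).
Qed.

Definition tgen (x : X) : Q := tpi (tvar k x).
End TPres.

(* The h-adic completion of the k[[h]]-algebra A (x) B, the latter being the
   k[[h]]-algebra on symbols (a, b) subject to bilinearity and to the product
   rule; [tpres] performs the completion. *)
Section CompletedTensor.
Variables (k : fieldType) (A B : hAlgType k).
Local Notation "[t a , b ]" := (tvar k ((a, b) : A * B)).

Inductive ctens_rel : tfree k (A * B)%type -> Prop :=
| CTensDl a a' b : ctens_rel ([t a + a', b] - ([t a, b] + [t a', b]))
| CTensDr a b b' : ctens_rel ([t a, b + b'] - ([t a, b] + [t a, b']))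
| CTensZl c a b : ctens_rel ([t c%:H * a, b] - c%:H * [t a, b])
| CTensZr c a b : ctens_rel ([t a, c%:H * b] - c%:H * [t a, b])
| CTensM a a' b b' : ctens_rel ([t a, b] * [t a', b'] - [t a * a', b * b'])
| CTens1 : ctens_rel ([t 1, 1] - 1).

Definition ctens : Type := tpres ctens_rel.
HB.instance Definition _ := HAlgebra.on ctens.

Definition tens (a : A) (b : B) : ctens := tgen ctens_rel (a, b).
End CompletedTensor.

Notation "a ⊗ b" := (tens a b) (at level 40, left associativity).

Section QNumbers.
Variable k : fieldType.

Definition q : fps k := qexp (1 : fps k^o).

(* (q^n - q^-n)/(q - q^-1); numerator and denominator are both divisible by h
   in k[[h]], and the denominator divided by h is a unit (see [qnumE]). *)
Definition qnum (n : nat) : fps k :=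
  fps_divh (q ^+ n - q ^- n) / fps_divh (q - q^-1).

Lemma hdvd_qexp (A : hAlgType k) (x : A) n :
  hdvd n ((fpsX ^+ n / n`!%:R)%:H * x ^+ n).
Proof. by exists ((n`!%:R^-1)%:H * x ^+ n); rewrite hscalM mulrA. Qed.

Lemma coef_q01 : coef q 0 = 1 /\ coef q 1 = 1.
Proof.
have qE := hlimP (@fps_separated _ _) (fps_complete (@hdvd_qexp (fps k^o) 1)).
have {qE}qE m : coef q m =
    coef (\sum_(n < m.+1) (fpsX ^+ n / n`!%:R)%:H * (1 : fps k^o) ^+ n) m.
  by rewrite -[q]/(hlim _) qE.
rewrite !qE !big_ord_recl !big_ord0 !addr0 !expr1n !mulr1.
rewrite !coef_fpsD expr0 expr1 !divr1 hscal1 /=.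
by rewrite add0r scale1r.
Qed.

Lemma qnumE n : [pchar k] =i pred0 -> qnum n * (q - q^-1) = q ^+ n - q ^- n.
Proof.
move=> char0; have [q0 q1] := coef_q01.
have uq : q \is a GRing.unit by rewrite -[_ \is a _]/(coef q 0 != 0) q0 oner_neq0.
have coefM0 (f g : fps k) : coef (f * g) 0 = coef f 0 * coef g 0.
  by rewrite coef_fpsM big_ord1.
have qV0 : coef q^-1 0 = 1.
  have /fpsP/(_ 0%N) := divrr uq.
  by rewrite coefM0 q0 mul1r coef_fps1.
have qV1 : coef q^-1 1 = - 1.
  have /fpsP/(_ 1%N) := divrr uq.
  rewrite coef_fpsM !big_ord_recl big_ord0 /= q0 q1 qV0 !mul1r addr0.
  by move/eqP; rewrite addr_eq0 => /eqP.
have qX0 (f : fps k) : coef f 0 = 1 -> coef (f ^+ n) 0 = 1.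
  by move=> f0; elim: n => // m IHm; rewrite exprS coefM0 f0 IHm mulr1.
have ud : fps_divh (q - q^-1) \is a GRing.unit.
  rewrite -[_ \is a _]/(coef q 1 - coef q^-1 1 != 0) q1 qV1 opprK -[1 + 1]/(2%:R).
  by move/pcharf0P: char0 => ->.
have e1 : fpsX * fps_divh (q - q^-1) = q - q^-1.
  by apply: fps_divhK; rewrite coef_fpsB q0 qV0 subrr.
have e2 : fpsX * fps_divh (q ^+ n - q ^- n) = q ^+ n - q ^- n.
  by apply: fps_divhK; rewrite coef_fpsB -exprVn !qX0 // subrr.
transitivity (qnum n * (fpsX * fps_divh (q - q^-1))); first by rewrite e1.
by rewrite /qnum mulrCA divrK // e2.
Qed.

Definition qfact (n : nat) : fps k := \prod_(1 <= i < n.+1) qnum i.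
End QNumbers.

(* gHt is the generator written H with a tilde. *)
Inductive sl2_gen : Type := gE | gF | gH | gHt.
HB.instance Definition _ := gen_eqMixin sl2_gen.
HB.instance Definition _ := gen_choiceMixin sl2_gen.

Section Dsl2.
Variable k : fieldType.

(* (q^H - q^Ht)/(q - q^-1) is computed in the h-torsion-free algebra
   k<E,F,H,Ht>[[h]], dividing numerator and denominator by h first. *)
Definition sl2_rel : tfree k sl2_gen -> Prop :=
  let E := tvar k gE in let F := tvar k gF in
  let H := tvar k gH in let Ht := tvar k gHt in
  let comm x y := x * y - y * x in
  fun r => r \in
    [:: comm H E - 2%:R * E;
        comm Ht E + 2%:R * E;
        comm H F + 2%:R * F;
        comm Ht F - 2%:R * F;
        comm E F - ((fps_divh (q k - (q k)^-1))^-1)%:H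
                     * fps_divh (qexp H - qexp Ht);
        comm H Ht].

Definition Dsl2 : Type := tpres sl2_rel.
HB.instance Definition _ := HAlgebra.on Dsl2.

Definition dE : Dsl2 := tgen sl2_rel gE.
Definition dF : Dsl2 := tgen sl2_rel gF.
Definition dH : Dsl2 := tgen sl2_rel gH.
Definition dHt : Dsl2 := tgen sl2_rel gHt.
Definition inv2 : fps k := 2%:R^-1.

Definition dc : Dsl2 := - (inv2%:H * (dH + dHt)).
Definition dH' : Dsl2 := dH + dc.
Definition dE' : Dsl2 := dE.
Definition dF' : Dsl2 := qexp dc * dF.

Definition Dsl2_2 : Type := ctens Dsl2 Dsl2.
HB.instance Definition _ := HAlgebra.on Dsl2_2.

Definition Rmat : Dsl2_2 :=
  hsum (fun n => ((q k - (q k)^-1) ^+ n / qfact k n)%:H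
    * qexp (- (inv2%:H * (dH ⊗ dHt)) + ((n * n.-1)%:R / 2%:R)%:H)
    * (dE ^+ n ⊗ dF ^+ n)).

Definition Rcheck : Dsl2_2 :=
  hsum (fun n => ((q k - (q k)^-1) ^+ n / qfact k n)%:H
    * qexp (inv2%:H * (dH' ⊗ dH') + ((n * n.-1)%:R / 2%:R)%:H)
    * (dE' ^+ n ⊗ dF' ^+ n)).
End Dsl2.

(* Main.v *)
(** Writing H = H' - c and Ht = - H' - c with c central gives
      - H ⊗ Ht = H' ⊗ H' + H' ⊗ c - c ⊗ H' - c ⊗ c,
    and all these tensors commute; the two factors on the left therefore turn
    the Cartan part of R into q^(H' ⊗ H' / 2 + H' ⊗ c / 2).  Since
    E^n H' = (H' - 2n) E^n, moving q^(- H' ⊗ c / 2) from the right through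
    E^n ⊗ F^n cancels the remaining q^(H' ⊗ c / 2) and leaves 1 ⊗ q^(nc), which
    is what turns F^n into F'^n. *)

Require Import Defs.
From HB Require Import structures.
From mathcomp Require Import all_boot all_order all_algebra.
From mathcomp Require Import boolp.
Local Open Scope ring_scope.

Set Implicit Arguments.
Unset Strict Implicit.
Unset Printing Implicit Defensive.

Import GRing.Theory.

(** * Completeness for the h-adic topology *)

(** Separatedness makes h-adic limits unique, so that [hlim] computes them. Convergence is asked
    only of series with n-th term in h^n A, the shape of [qexp] and of both R-matrices. *)
Definition hcomplete (k : fieldType) (A : hAlgType k) : Prop :=
  (forall x : A, (forall m, hdvd m x) -> x = 0) /\
  (forall u : nat -> A, (forall n, hdvd n (u n)) ->
     exists l, hcvg (fun N => \sum_(n < N) u n) l).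

Lemma tpres_hcomplete (k : fieldType) (X : choiceType) (S : tfree k X -> Prop) :
  hcomplete (tpres S).
Proof. by split; [exact: tpres_separated | exact: tpres_complete]. Qed.

(** A series is a unit when its constant term is nonzero, and here this term is n in k. *)
Lemma fps_nat_unit (k : fieldType) n : [pchar k] =i pred0 -> n != 0%N ->
  (n%:R : fps k) \is a GRing.unit.
Proof.
move=> /pcharf0P char0; rewrite -char0 -[_ \is a _]/(coef _ 0 != 0).
suff -> : coef (n%:R : fps k) 0 = n%:R by [].
by elim: n => // n IHn; rewrite !mulrSr coef_fpsD IHn.
Qed.

(** * Central scalars and divisibility by powers of h *)

Section HScalars.
Variables (k : fieldType) (A : hAlgType k).
Implicit Types (c d : fps k) (x y z t a b : A).

Lemma hscal0 : 0%:H = 0 :> A.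
Proof. by apply: (addrI 0%:H); rewrite -hscalD !addr0. Qed.

Lemma hscalN c : (- c)%:H = - c%:H :> A.
Proof. by apply: (addrI c%:H); rewrite -hscalD !subrr hscal0. Qed.

Lemma hscal_nat n : n%:R%:H = n%:R :> A.
Proof. by elim: n => [|n IHn]; rewrite ?hscal0 // !mulrSr hscalD IHn hscal1. Qed.

Lemma comm_hscal c x : GRing.comm x c%:H.
Proof. by rewrite /GRing.comm hscalC. Qed.

Lemma hscalMM c d x y : c%:H * x * (d%:H * y) = (c * d)%:H * (x * y).
Proof. by rewrite hscalM -!mulrA; congr (_ * _); rewrite !mulrA hscalC. Qed.

Lemma hdvdMl m x y : hdvd m x -> hdvd m (y * x).
Proof. by move=> [z ->]; exists (y * z); rewrite mulrA -hscalC -mulrA. Qed.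

Lemma hdvdMr m x y : hdvd m x -> hdvd m (x * y).
Proof. by move=> [z ->]; exists (z * y); rewrite mulrA. Qed.

Lemma hdvd0 m : hdvd m (0 : A).
Proof. by exists 0; rewrite mulr0. Qed.

Lemma hdvd_sum m (I : Type) (r : seq I) (P : pred I) (F : I -> A) :
  (forall i, P i -> hdvd m (F i)) -> hdvd m (\sum_(i <- r | P i) F i).
Proof. by move=> mF; apply: big_ind => //; [exact: hdvd0 | exact: hdvdD]. Qed.

Lemma hdvdW m n x : (n <= m)%N -> hdvd m x -> hdvd n x.
Proof.
move=> le_nm [y ->]; exists ((fpsX ^+ (m - n))%:H * y).
by rewrite mulrA -hscalM -exprD subnKC.
Qed.

Lemma hdvdM m n x y : hdvd m x -> hdvd n y -> hdvd (m + n) (x * y).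
Proof. by move=> [a ->] [b ->]; exists (a * b); rewrite hscalMM -exprD. Qed.

Lemma hcvgMl u l y : @hcvg k A u l -> hcvg (fun n => y * u n) (y * l).
Proof.
move=> ul m; have [N uN] := ul m; exists N => n le_Nn.
by rewrite -mulrBr; apply/hdvdMl/uN.
Qed.

Lemma hcvgMr u l y : @hcvg k A u l -> hcvg (fun n => u n * y) (l * y).
Proof.
move=> ul m; have [N uN] := ul m; exists N => n le_Nn.
by rewrite -mulrBl; apply/hdvdMr/uN.
Qed.

Lemma eq_hcvg u v l : u =1 v -> @hcvg k A u l -> hcvg v l.
Proof.
move=> uv ul m; have [N uN] := ul m; exists N => n le_Nn.
by rewrite -uv; apply: uN.
Qed.
(** Cancels the weight 2n of E^n against the 1/2 in the Cartan exponents. *)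
Lemma inv2_natM x n : [pchar k] =i pred0 ->
  (inv2 k)%:H * ((2 * n)%:R * x) = x *+ n.
Proof.
move=> /fps_nat_unit unit_nat.
rewrite natrM -(hscal_nat 2) !mulrA -hscalM mulVr ?unit_nat // hscal1 mul1r.
by rewrite mulr_natl.
Qed.
(** Sets aside the central coefficient of the n-th term of an R-matrix. *)
Lemma hscal_factor c a x y b z t :
  a * (x * y) * b = z * t -> a * (c%:H * x * y) * b = c%:H * z * t.
Proof. by move=> e; rewrite -[RHS]mulrA -e !mulrA hscalC. Qed.
End HScalars.

(** * Sums of h-adic series and the exponential q^x *)

Section HExponential.
Variables (k : fieldType) (A : hAlgType k).
Hypothesis complA : hcomplete A.
Implicit Types (x y z : A) (u v : nat -> A).

Lemma hcvg_hsum u : (forall n, hdvd n (u n)) ->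
  hcvg (fun N => \sum_(n < N) u n) (hsum u).
Proof.
case: complA => sepA cvgA /cvgA[l ul].
by rewrite /hsum (hlimP sepA ul).
Qed.

Lemma hsumE u l : hcvg (fun N => \sum_(n < N) u n) l -> hsum u = l.
Proof. by case: complA => sepA _; apply: hlimP. Qed.

Lemma eq_hsum u v : u =1 v -> (forall n, hdvd n (u n)) -> hsum u = hsum v.
Proof.
move=> uv hu; symmetry; apply: hsumE; apply: eq_hcvg (hcvg_hsum hu) => N.
by apply: eq_bigr.
Qed.

Lemma hsumMl u y : (forall n, hdvd n (u n)) ->
  y * hsum u = hsum (fun n => y * u n).
Proof.
move=> hu; symmetry; apply: hsumE; apply: eq_hcvg (hcvgMl y (hcvg_hsum hu)).
by move=> N; rewrite mulr_sumr.
Qed.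

Lemma hsumMr u y : (forall n, hdvd n (u n)) ->
  hsum u * y = hsum (fun n => u n * y).
Proof.
move=> hu; symmetry; apply: hsumE; apply: eq_hcvg (hcvgMr y (hcvg_hsum hu)).
by move=> N; rewrite mulr_suml.
Qed.

(** Reduces an identity between sums to its terms; v inherits its convergence from u. *)
Lemma hsum_mul2 u v a b : (forall n, hdvd n (u n)) ->
  (forall n, a * u n * b = v n) -> a * hsum u * b = hsum v.
Proof.
move=> hu uv; rewrite hsumMl // hsumMr => [|n]; last exact/hdvdMl.
by apply: eq_hsum => // n; apply/hdvdMr/hdvdMl.
Qed.

(** Cauchy product: the triangular partial sum differs from the product of partial sums by terms u_i
    v_j with i + j >= n, which lie in h^n A. *)
Lemma hsum_mul u v : (forall n, hdvd n (u n)) -> (forall n, hdvd n (v n)) ->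
  hsum u * hsum v = hsum (fun n => \sum_(i < n.+1) u i * v (n - i)%N).
Proof.
move=> hu hv; symmetry; apply: hsumE => m.
have [N uN] := hcvg_hsum hu m; have [N' vN'] := hcvg_hsum hv m.
(* The bound m makes the terms outside the triangle divisible by h^m; N and N' control the two
   partial sums. *)
exists (maxn m (maxn N N')) => n; rewrite !geq_max => /and3P[le_mn le_Nn le_N'n].
(* Regroup the triangle by the index of u, adding one antidiagonal at each step of the induction. *)
have -> : \sum_(i < n) \sum_(j < i.+1) u j * v (i - j)%N
        = \sum_(j < n) \sum_(i < n | (j + i < n)%N) u j * v i.
  elim: n {le_mn le_Nn le_N'n} => [|n IHn]; first by rewrite !big_ord0.
  rewrite big_ord_recr /= {}IHn [in RHS]big_ord_recr /=.
  have -> : \sum_(i < n.+1 | (n + i < n.+1)%N) u n * v i = u n * v 0%N.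
    rewrite big_mkcond big_ord_recl /= addn0 ltnSn big1 ?addr0 // => i _.
    by rewrite /bump /= add1n addnS ltnNge ltnS leq_addr.
  rewrite [X in _ + X]big_ord_recr /= subnn addrA; congr (_ + _).
  rewrite -big_split /=; apply: eq_bigr => j _.
  have lt_jn := ltn_ord j.
  have le1 : (n - j <= n)%N by rewrite leq_subr.
  have le2 : ((n - j).+1 <= n.+1)%N by rewrite ltnS leq_subr.
  rewrite (eq_bigl (fun i : 'I_n => (i < n - j)%N)); last first.
    by move=> i; rewrite ltn_subRL.
  rewrite [RHS](eq_bigl (fun i : 'I_n.+1 => (i < (n - j).+1)%N)); last first.
    by move=> i; rewrite !ltnS leq_subRL // ltnW.
  rewrite -(big_ord_widen n (fun i => u j * v i)) //.
  rewrite -(big_ord_widen n.+1 (fun i => u j * v i)) //.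
  by rewrite [RHS]big_ord_recr.
(* Compare first with the square p of all pairs of indices below n, then p with the product of the
   limits. *)
set s := \sum_(j < n) _; pose p := (\sum_(i < n) u i) * (\sum_(i < n) v i).
rewrite -(subrK p s) -addrA; apply: hdvdD; rewrite {}/p {}/s.
  rewrite mulr_suml -sumrB; apply: hdvd_sum => i _.
  rewrite mulr_sumr [X in _ - X](bigID (fun j : 'I_n => (i + j < n)%N)) /=.
  rewrite opprD addrA subrr add0r; apply/hdvdN/hdvd_sum => j.
  rewrite -leqNgt => le_nij; apply: hdvdW (leq_trans le_mn le_nij) _.
  by apply: hdvdM.
have -> : (\sum_(i < n) u i) * (\sum_(i < n) v i) - hsum u * hsum v
  = (\sum_(i < n) u i - hsum u) * (\sum_(i < n) v i)
    + hsum u * (\sum_(i < n) v i - hsum v).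
  by rewrite mulrBl mulrBr addrA subrK.
by apply: hdvdD; [apply/hdvdMr/uN | apply/hdvdMl/vN'].
Qed.

(** The binomial theorem for commuting elements matches the Cauchy product term by term. *)
Lemma qexpD x y : [pchar k] =i pred0 -> GRing.comm x y ->
  qexp (x + y) = qexp x * qexp y.
Proof.
move=> /fps_nat_unit unit_nat xy; rewrite /qexp hsum_mul; try exact: hdvd_qexp.
apply: eq_hsum => [n|]; last exact: hdvd_qexp.
have fact_unit m : (m`!%:R : fps k) \is a GRing.unit.
  by rewrite unit_nat // -lt0n fact_gt0.
(* Swapping the summands makes i the exponent of x, as in the Cauchy product. *)
rewrite addrC exprDn_comm // mulr_sumr; apply: eq_bigr => i _.
have le_in : (i <= n)%N by rewrite -ltnS.
rewrite hscalMM -[_ *+ 'C(n, i)]mulr_natl -hscal_nat mulrA -hscalM.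
rewrite (commrX _ (commr_sym (commrX _ xy))).
congr (_%:H * _).
rewrite mulrACA -exprD subnKC // -mulrA; congr (_ * _).
(* Multiplying by n! leaves the identity C(n,i) i! (n-i)! = n!. *)
apply: (mulrI (fact_unit n)); rewrite mulrA mulrV // mul1r.
by rewrite -(bin_fact le_in) !natrM -mulrA mulrACA !divrr // !mulr1.
Qed.

(** By induction z x^n = y^n z, and left and right multiplication commute with h-adic sums. *)
Lemma qexp_conj x y z : z * x = y * z -> z * qexp x = qexp y * z.
Proof.
move=> zx; rewrite /qexp hsumMl ?hsumMr; try exact: hdvd_qexp.
apply: eq_hsum => n; last by apply/hdvdMl/hdvd_qexp.
rewrite mulrA -hscalC -!mulrA; congr (_ * _).
elim: n => [|n IHn]; first by rewrite mul1r mulr1.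
by rewrite exprSr mulrA IHn -mulrA zx mulrA exprSr.
Qed.

Lemma comm_qexp x y : GRing.comm x y -> GRing.comm x (qexp y).
Proof. exact: qexp_conj. Qed.

Lemma qexp0 : qexp (0 : A) = 1.
Proof.
(* Every nonempty partial sum equals its term 0^0 = 1. *)
apply: hsumE => m; exists 1%N => -[//|n] _.
rewrite big_ord_recl big1 => [|i _]; last by rewrite expr0n mulr0.
by rewrite !expr0 divr1 hscal1 mul1r addr0 subrr; apply: hdvd0.
Qed.

Lemma qexpMn x n : [pchar k] =i pred0 -> qexp (x *+ n) = qexp x ^+ n.
Proof.
move=> char0; elim: n => [|n IHn]; first by rewrite mulr0n qexp0.
by rewrite mulrS qexpD // ?IHn ?exprS //; apply: commrMn.
Qed.

(* Stated for an indexed family, so that a single hypothesis expresses that all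
   the exponents commute. *)
Lemma qexp_collect (I : Type) (g : I -> A) (w : fps k) (p r s t v : I) :
    [pchar k] =i pred0 -> (forall i j, GRing.comm (g i) (g j)) ->
  qexp (g t) * qexp (g s) * qexp (g p + g r - g s - g t + w%:H)
    * qexp (- g r + g v) = qexp (g p + w%:H) * qexp (g v).
Proof.
move=> char0 gC.
have commD a b x : GRing.comm a x -> GRing.comm b x -> GRing.comm (a + b) x.
  by move=> ax bx; apply/commr_sym/commrD; apply: commr_sym.
have wC x : GRing.comm w%:H x by apply/commr_sym/comm_hscal.
pose z := g p + g r - g s - g t + w%:H.
have gz i : GRing.comm (g i) z.
  do ![apply: commrD]; try apply: commrN; do ?exact: gC.
  exact: comm_hscal.
have gy i : GRing.comm (g i) (- g r + g v).
  by apply: commrD; first apply: commrN.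
have yz : GRing.comm (- g r + g v) z.
  by apply: commD; first apply/commr_sym/commrN/commr_sym.
rewrite -!(qexpD char0) -/z //; try exact: commr_sym yz; do ?apply: (commD) => //.
congr qexp.
have -> : z = g p + w%:H + g r - (g t + g s).
  by rewrite /z -(addrA (g p + g r)) -opprD (addrC (g t)) addrAC (addrAC (g p)).
by rewrite [g t + g s + _]addrC subrK addrA addrK.
Qed.

(** By [qexp_conj], q^(- g r) crosses z at the cost of q^(g v); [qexp_collect] then merges the
    exponentials. *)
Lemma qexp_twist (I : Type) (g : I -> A) (w : fps k) (p r s t v : I) z :
    [pchar k] =i pred0 -> (forall i j, GRing.comm (g i) (g j)) ->
    z * - g r = (- g r + g v) * z ->
  qexp (g t) * qexp (g s) * (qexp (g p + g r - g s - g t + w%:H) * z)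
    * qexp (- g r) = qexp (g p + w%:H) * (qexp (g v) * z).
Proof.
move=> char0 gC /qexp_conj zr.
rewrite -[LHS]mulrA -[X in _ * X]mulrA zr [RHS]mulrA.
by rewrite -(@qexp_collect _ g w p r s t v) // !mulrA.
Qed.
End HExponential.

(** * Calculus in the completed tensor product *)

Section TensorCalculus.
Variables (k : fieldType) (A B : hAlgType k).
Implicit Types (a : A) (b : B) (c : fps k).

Lemma tpi_relator (X : choiceType) (S : tfree k X -> Prop) r :
  S r -> tpi S r = 0.
Proof.
move=> Sr; rewrite -(tpi0 S); apply/tpi_eq; rewrite subr0.
apply/asboolP => m; exists r; first exact: in_ideal_gen.
by rewrite subrr; apply: hdvd0.
Qed.

Lemma tensDl a a' b : (a + a') ⊗ b = a ⊗ b + a' ⊗ b.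
Proof.
apply/eqP; rewrite -subr_eq0; apply/eqP.
by have := tpi_relator (CTensDl a a' b); rewrite tpiB tpiD.
Qed.

Lemma tensDr a b b' : a ⊗ (b + b') = a ⊗ b + a ⊗ b'.
Proof.
apply/eqP; rewrite -subr_eq0; apply/eqP.
by have := tpi_relator (CTensDr a b b'); rewrite tpiB tpiD.
Qed.

Lemma tensZl c a b : (c%:H * a) ⊗ b = c%:H * (a ⊗ b).
Proof.
apply/eqP; rewrite -subr_eq0; apply/eqP.
by have := tpi_relator (CTensZl c a b); rewrite tpiB tpiM.
Qed.

Lemma tensZr c a b : a ⊗ (c%:H * b) = c%:H * (a ⊗ b).
Proof.
apply/eqP; rewrite -subr_eq0; apply/eqP.
by have := tpi_relator (CTensZr c a b); rewrite tpiB tpiM.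
Qed.

Lemma tensM a a' b b' : (a ⊗ b) * (a' ⊗ b') = (a * a') ⊗ (b * b').
Proof.
apply/eqP; rewrite -subr_eq0; apply/eqP.
by have := tpi_relator (CTensM a a' b b'); rewrite tpiB tpiM.
Qed.

Lemma tens1 : (1 : A) ⊗ (1 : B) = 1.
Proof.
apply/eqP; rewrite -subr_eq0; apply/eqP.
by have := tpi_relator (CTens1 A B); rewrite tpiB.
Qed.

Lemma tensNl a b : (- a) ⊗ b = - (a ⊗ b).
Proof. by rewrite -mulN1r -(@hscal1 k A) -hscalN tensZl hscalN hscal1 mulN1r. Qed.

Lemma tensNr a b : a ⊗ (- b) = - (a ⊗ b).
Proof. by rewrite -mulN1r -(@hscal1 k B) -hscalN tensZr hscalN hscal1 mulN1r. Qed.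

Lemma tens0r a : a ⊗ (0 : B) = 0.
Proof. by rewrite -(mul0r 0) -(@hscal0 k B) tensZr hscal0 mul0r. Qed.

Lemma comm_tens a a' b b' :
  GRing.comm a a' -> GRing.comm b b' -> GRing.comm (a ⊗ b) (a' ⊗ b').
Proof. by rewrite /GRing.comm !tensM => -> ->. Qed.

Lemma tens_exp a b n : (a ⊗ b) ^+ n = (a ^+ n) ⊗ (b ^+ n).
Proof. by elim: n => [|n IHn]; rewrite ?tens1 // !exprS IHn tensM. Qed.

(** The map b -> 1 ⊗ b is multiplicative, linear over k[[h]] and sends h^m B into h^m times the
    tensor product, so it carries the partial sums and their limit across. *)
Lemma tens_qexp1 b : hcomplete B -> (1 : A) ⊗ (qexp b) = qexp ((1 : A) ⊗ b).
Proof.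
move=> complB; symmetry; apply: hsumE => [|m]; first exact: tpres_hcomplete.
have sumE n : \sum_(i < n) (fpsX ^+ i / i`!%:R)%:H * ((1 : A) ⊗ b) ^+ i
    = 1 ⊗ (\sum_(i < n) (fpsX ^+ i / i`!%:R)%:H * b ^+ i).
  elim: n => [|n IHn]; first by rewrite !big_ord0 tens0r.
  by rewrite !big_ord_recr /= tensDr IHn tensZr tens_exp expr1n.
have [N bN] := hcvg_hsum complB (hdvd_qexp b) m.
exists N => n /bN[y sy]; rewrite sumE.
by exists (1 ⊗ y); rewrite -tensNr -tensDr sy tensZr.
Qed.
End TensorCalculus.

(** * Weight relations in an arbitrary ring *)

Section Weights.
Variables (A : pzRingType) (x y z : A).

Lemma commutator_subE (a : A) : x * y - y * x - a * y = 0 -> y * x = (x - a) * y.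
Proof.
by move/eqP; rewrite subr_eq0 subr_eq addrC -subr_eq -mulrBl => /eqP.
Qed.

Lemma weight_addr (a : A) :
  x * y = (y - a) * x -> GRing.comm x z -> x * (y + z) = (y + z - a) * x.
Proof. by move=> xy xz; rewrite mulrDr xy xz -mulrDl addrAC. Qed.

(** Each factor x that y crosses shifts y by -m. *)
Lemma weightX m n :
  x * y = (y - m%:R) * x -> x ^+ n * y = (y - (m * n)%:R) * x ^+ n.
Proof.
move=> xy; elim: n => [|n IHn]; first by rewrite muln0 mul1r mulr1 subr0.
rewrite exprS -mulrA IHn mulrA mulrBr xy commr_nat -mulrBl.
by rewrite -addrA -opprD -natrD mulnS -mulrA.
Qed.

Lemma weight_opp_scale (a u : A) : GRing.comm a x ->
  x * y = (y - u) * x -> x * - (a * y) = (- (a * y) + a * u) * x.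
Proof.
move=> ax xy; rewrite mulrN mulrA -ax -mulrA xy mulrA -mulNr.
by rewrite mulrBr opprB addrC.
Qed.
End Weights.

(** * The defining relations of [Dsl2], read as weight relations *)

Section Dsl2Relations.
Variable k : fieldType.
Local Notation E := (dE k).
Local Notation F := (dF k).
Local Notation H := (dH k).
Local Notation Ht := (dHt k).

Lemma tpi_lie (X : choiceType) (S : tfree k X -> Prop) (x y : tfree k X) :
  tpi S (x * y - y * x) = tpi S x * tpi S y - tpi S y * tpi S x.
Proof. by rewrite tpiB !tpiM. Qed.

Lemma tpi_natMl (X : choiceType) (S : tfree k X -> Prop) n (x : tfree k X) :
  tpi S (n%:R * x) = n%:R * tpi S x.
Proof. by rewrite tpiM -hscal_nat -[in RHS]hscal_nat. Qed.

Lemma relator_weightN (S : tfree k sl2_gen -> Prop) (x y : sl2_gen) n :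
    S (tvar k x * tvar k y - tvar k y * tvar k x - n%:R * tvar k y) ->
  tgen S y * tgen S x = (tgen S x - n%:R) * tgen S y.
Proof.
move=> /tpi_relator; rewrite tpiB tpi_lie tpi_natMl.
exact: commutator_subE.
Qed.

Lemma relator_weightD (S : tfree k sl2_gen -> Prop) (x y : sl2_gen) n :
    S (tvar k x * tvar k y - tvar k y * tvar k x + n%:R * tvar k y) ->
  tgen S y * tgen S x = (tgen S x + n%:R) * tgen S y.
Proof.
move=> /tpi_relator; rewrite tpiD tpi_lie tpi_natMl -[n%:R in LHS]opprK mulNr.
by move/commutator_subE; rewrite opprK.
Qed.

Lemma Dsl2_HE : E * H = (H - 2%:R) * E.
Proof. by apply: (@relator_weightN (@sl2_rel k) gH gE); exact: mem_head. Qed.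

Lemma Dsl2_HtE : E * Ht = (Ht + 2%:R) * E.
Proof.
apply: (@relator_weightD (@sl2_rel k) gHt gE).
by apply/predU1P; right; apply/predU1P; left.
Qed.

Lemma Dsl2_HF : F * H = (H + 2%:R) * F.
Proof.
apply: (@relator_weightD (@sl2_rel k) gH gF).
by do 2!(apply/predU1P; right); apply/predU1P; left.
Qed.

Lemma Dsl2_HtF : F * Ht = (Ht - 2%:R) * F.
Proof.
apply: (@relator_weightN (@sl2_rel k) gHt gF).
by do 3!(apply/predU1P; right); apply/predU1P; left.
Qed.

Lemma Dsl2_HHt : GRing.comm H Ht.
Proof.
have HHt : sl2_rel (tvar k gH * tvar k gHt - tvar k gHt * tvar k gH).
  by do 5!(apply/predU1P; right); apply/predU1P; left.
have := tpi_relator HHt; rewrite tpi_lie => /eqP.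
by rewrite subr_eq0 => /eqP.
Qed.
End Dsl2Relations.

(* Otherwise a failing unification of two distinct generators unfolds the
   quotient construction and does not terminate in practice. *)
Opaque tgen tpi tpres_mul.

(** * The central element c and the change of Cartan generators *)

Section Dsl2Cartan.
Variable k : fieldType.
Local Notation E := (dE k).
Local Notation F := (dF k).
Local Notation H := (dH k).
Local Notation Ht := (dHt k).
Local Notation c := (dc k).
Local Notation H' := (dH' k).

Lemma comm_Hc : GRing.comm H c.
Proof.
apply/commrN/commrM; first exact: comm_hscal.
exact: commrD (commr_refl _) (Dsl2_HHt k).
Qed.

(** E shifts H and Ht by opposite amounts, so it commutes with their sum; likewise for F below. *)
Lemma comm_Ec : GRing.comm E c.
Proof.
apply/commrN/commrM; first exact: comm_hscal.
by rewrite /GRing.comm mulrDr Dsl2_HE Dsl2_HtE -mulrDl addrACA addNr addr0.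
Qed.

Lemma comm_Fc : GRing.comm F c.
Proof.
apply/commrN/commrM; first exact: comm_hscal.
by rewrite /GRing.comm mulrDr Dsl2_HF Dsl2_HtF -mulrDl addrACA subrr addr0.
Qed.

Lemma comm_H'c : GRing.comm H' c.
Proof. exact: commr_sym (commrD (commr_sym comm_Hc) (commr_refl c)). Qed.

Lemma Dsl2_H_E : H = H' - c.
Proof. by rewrite addrK. Qed.

(** Since 2c = - H - Ht, one has H' + c = H + 2c = - Ht; characteristic zero makes 2 invertible. *)
Lemma Dsl2_Ht_E : [pchar k] =i pred0 -> Ht = - H' - c.
Proof.
move=> /fps_nat_unit unit_nat.
rewrite /dH' opprD -addrA -opprD -mulr2n -mulNrn opprK -mulrnAr -mulr_natl.
rewrite -hscal_nat mulrA -hscalM mulVr ?unit_nat // hscal1 mul1r.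
by rewrite addrA addNr add0r.
Qed.
End Dsl2Cartan.

(** * The twist of a single term, for abstract e, f, x, c *)

Section TensorSquare.
Variable k : fieldType.
Hypothesis char0 : [pchar k] =i pred0.

Variables (D : hAlgType k) (e f x c : D).
Hypotheses (complD : hcomplete D) (ex : e * x = (x - 2%:R) * e).
Hypotheses (fc : GRing.comm f c) (xc : GRing.comm x c).
Local Notation hf := ((inv2 k)%:H : ctens D D).

(** Crossing e^n shifts x by -2n, hence -(x ⊗ c)/2 by n (1 ⊗ c); f^n commutes with c. *)
Lemma tens_pass n :
  (e ^+ n ⊗ f ^+ n) * - (hf * (x ⊗ c))
  = (- (hf * (x ⊗ c)) + (1 ⊗ c) *+ n) * (e ^+ n ⊗ f ^+ n).
Proof.
have fnc : GRing.comm (f ^+ n) c by apply/commr_sym/commrX/commr_sym.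
have xcW : (e ^+ n ⊗ f ^+ n) * (x ⊗ c)
    = (x ⊗ c - (2 * n)%:R * (1 ⊗ c)) * (e ^+ n ⊗ f ^+ n).
  rewrite tensM (weightX n ex) fnc -tensM tensDl tensNl.
  by rewrite -[X in - (X ⊗ _)]mulr1 -(@hscal_nat k D) tensZl hscal_nat.
rewrite (weight_opp_scale (commr_sym (comm_hscal _ _)) xcW).
by congr ((_ + _) * _); exact: inv2_natM.
Qed.

(* The equations on a and b are hypotheses because rewriting with them under
   ⊗ in the square of Dsl2 does not terminate in practice. *)
Lemma exponent_E a b : a = x - c -> b = - x - c ->
  - (hf * (a ⊗ b))
  = hf * (x ⊗ x) + hf * (x ⊗ c) - hf * (c ⊗ x) - hf * (c ⊗ c).
Proof.
move=> -> ->.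
have -> : (x - c) ⊗ (- x - c) = - (x ⊗ x + x ⊗ c - c ⊗ x - c ⊗ c).
  by rewrite -opprD tensNr tensDr !tensDl !tensNl addrACA addrA.
by rewrite mulrN opprK !mulrBr mulrDr.
Qed.

(** The n-th term of the theorem without its scalar coefficient: w stands for n(n-1)/2 and m for - H
    ⊗ Ht / 2. *)
Lemma twist_coef (w : fps k) n (m : ctens D D) :
  m = hf * (x ⊗ x) + hf * (x ⊗ c) - hf * (c ⊗ x) - hf * (c ⊗ c) ->
  qexp (hf * (c ⊗ c)) * qexp (hf * (c ⊗ x))
    * (qexp (m + w%:H) * (e ^+ n ⊗ f ^+ n))
    * qexp (- (hf * (x ⊗ c)))
  = qexp (hf * (x ⊗ x) + w%:H) * (e ^+ n ⊗ (qexp c * f) ^+ n).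
Proof.
move=> ->; have complT : hcomplete (ctens D D) by exact: tpres_hcomplete.
have -> : (qexp c * f) ^+ n = qexp c ^+ n * f ^+ n.
  by rewrite exprMn_comm //; apply/commr_sym/comm_qexp.
(* The factor q^(nc) of the second leg becomes the exponential of n (1 ⊗ c), the shift produced by
   [tens_pass]. *)
have -> : e ^+ n ⊗ (qexp c ^+ n * f ^+ n)
    = qexp ((1 ⊗ c) *+ n) * (e ^+ n ⊗ f ^+ n).
  rewrite (qexpMn complT _ _ char0) -(tens_qexp1 D c complD) tens_exp.
  by rewrite expr1n tensM mul1r.
(* One commuting family for all exponents: [Some (a, b)] indexes the four halved tensors in x and c,
   [None] the shift n (1 ⊗ c). *)
pose y b := if b then x else c.
pose g o := if o is Some (a, b) then hf * (y a ⊗ y b) else (1 ⊗ c) *+ n.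
have yC a b : GRing.comm (y a) (y b).
  case: a; case: b; [exact: commr_refl | exact: xc | | exact: commr_refl].
  exact: commr_sym xc.
apply: (@qexp_twist _ _ complT _ g w (Some (true, true)) (Some (true, false))
  (Some (false, true)) (Some (false, false)) None _ char0 _ (tens_pass n)).
have hfC z z' : GRing.comm z z' -> GRing.comm z (hf * z').
  exact: commrM (comm_hscal _ _).
have cC a b : GRing.comm (1 ⊗ c) (hf * (y a ⊗ y b)).
  exact: hfC (comm_tens (commr_sym (commr1 _)) (yC false b)).
move=> [[a b]|] [[a' b']|] /=.
- exact: hfC (commr_sym (hfC _ _ (comm_tens (yC _ _) (yC _ _)))).
- exact: commrMn (commr_sym (cC _ _)).
- apply: commr_sym; exact: commrMn (commr_sym (cC _ _)).
- apply: commrMn; apply: commr_sym; exact: commrMn (commr_refl _).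
Qed.
End TensorSquare.

(** * Convergence of the R-matrix series and conclusion *)

(** Both q and its inverse have constant term 1, so h divides q - q^-1 and h^n divides its n-th
    power. *)
Lemma hdvd_qnum_coef (k : fieldType) (A : hAlgType k) (d : fps k) n (y z : A) :
  hdvd n ((((q k - (q k)^-1) ^+ n) / d)%:H * y * z).
Proof.
have [q0 _] := coef_q01 k.
have uq : q k \is a GRing.unit.
  by rewrite -[_ \is a _]/(coef (q k) 0 != 0) q0 oner_neq0.
have qV0 : coef (q k)^-1 0 = 1.
  have /fpsP/(_ 0%N) := divrr uq.
  by rewrite coef_fpsM big_ord1 q0 mul1r coef_fps1.
have <- : fpsX * fps_divh (q k - (q k)^-1) = q k - (q k)^-1.
  by apply: fps_divhK; rewrite coef_fpsB q0 qV0 subrr.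
by apply: hdvdMr; rewrite exprMn -mulrA hscalM -mulrA; eexists.
Qed.

Theorem proposition3p11 (k : fieldType) (char0 : [pchar k] =i pred0) :
  qexp ((inv2 k)%:H * (dc k ⊗ dc k))
    * qexp ((inv2 k)%:H * (dc k ⊗ dH' k))
    * Rmat k
    * qexp (- ((inv2 k)%:H * (dH' k ⊗ dc k)))
  = Rcheck k :> Dsl2_2 k.
Proof.
have complT : hcomplete (Dsl2_2 k) by exact: tpres_hcomplete.
have complD : hcomplete (Dsl2 k) by exact: tpres_hcomplete.
apply: (hsum_mul2 complT) => n; first exact: hdvd_qnum_coef.
apply: hscal_factor.
(* E has the same weight for H' = H + c as for H, because it commutes with c. *)
apply: (twist_coef char0 complD (weight_addr (Dsl2_HE k) (@comm_Ec k))
  (@comm_Fc k) (@comm_H'c k)).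
exact: exponent_E (Dsl2_H_E k) (Dsl2_Ht_E char0).
Qed.
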